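(* Let $H$ be a complex Hilbert space, let $L_0$ be a (densely defined) symmetric minimal operator in $H$, let $\widehat{L}=L_0^*$ be the corresponding maximal operator, let $L$ be a self-adjoint correct extension of $L_0$, and let $L_K$ be a correct restriction of $\widehat{L}$, with $$L_K^{-1}f=L^{-1}f+Kf,\qquad f\in H,$$ where $K$ is a bounded linear operator on $H$ with $R(K)\subset \operatorname{Ker}\widehat{L}$. If $R(K^* )\subset D(L)$ and $KL\ge 0$, then $L_K$ is similar to a self-adjoint operator.
   Context: $D(\cdot)$, $R(\cdot)$, $\operatorname{Ker}$ denote domain, range and kernel; $I$ is the identity on $H$. A linear operator $A$ in $H$ is correctly solvable if there is $C>0$ with $\|u\|\le C\|Au\|$ for all $u\in D(A)$, and everywhere solvable if $R(A)=H$; $A$ is a correct operator if both hold (so $A^{-1}$ is a bounded operator defined on all of $H$). A correctly solvable operator $L_0$ is minimal if $\overline{R(L_0)}\ne H$. A closed operator $\widehat{L}$ is maximal if $R(\widehat{L})=H$ and $\operatorname{Ker}\widehat{L}\neq\{0\}$. $A$ is a restriction of $B$ (and $B$ an extension of $A$) if $D(A)\subset D(B)$ and $Au=Bu$ for $u\in D(A)$. A correct extension of $L_0$ (correct restriction of $\widehat L$) is an extension of $L_0$ (restriction of $\widehat L$) that is a correct operator. Every correct restriction $L_K$ of $\widehat{L}$ has inverse $L_K^{-1}=L^{-1}+K$ for a bounded linear operator $K$ from $H$ into $\operatorname{Ker}\widehat{L}$, and then $D(L_K)=\{u\in D(\widehat{L}): (I-K\widehat{L})u\in D(L)\}$. When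 $R(K^* )\subset D(L)$ (with $L=L^*$), the operator $KL$, defined on the dense set $D(L)$, is bounded there; $KL$ denotes its bounded extension (closure) to all of $H$. For a bounded operator $T$ on $H$, $T\ge 0$ means $(Tx,x)\ge 0$ for all $x\in H$. A (possibly unbounded) operator $A$ is similar to $B$ if $A=SBS^{-1}$ (with equality of domains, $D(A)=S\,D(B)$) for some bounded, boundedly invertible operator $S$ on $H$. *)

(* Defs.v *)
From mathcomp Require Import all_boot all_order all_algebra.
From mathcomp Require Import complex.
From mathcomp Require Import boolp classical_sets reals topology normedtype.

Set Implicit Arguments.
Unset Strict Implicit.
Unset Printing Implicit Defensive.

Import Order.TTheory GRing.Theory Num.Theory.
Import numFieldNormedType.Exports.

Local Open Scope classical_set_scope.
Local Open Scope ring_scope.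

Section Operators.
Context {R : realType} {H : completeNormedModType R[i]}.

(* The values of [opval] outside [opdom] are irrelevant; operators are compared
   with [opeq], never with Leibniz equality. *)
Record operator := Operator { opdom : set H; opval :> H -> H }.

Implicit Types (A B : operator) (S T K : H -> H).

Definition linear_operator A :=
  opdom A 0 /\
  forall (a : R[i]) (u v : H), opdom A u -> opdom A v ->
    opdom A (a *: u + v) /\ A (a *: u + v) = a *: A u + A v.

Definition oprange A : set H := [set A u | u in opdom A].

Definition opker A : set H := [set u | opdom A u /\ A u = 0].

Definition opgraph A : set (H * H) := [set (u, A u) | u in opdom A].

Definition restriction A B :=
  opdom A `<=` opdom B /\ (forall u, opdom A u -> A u = B u).

Definition opeq A B := restriction A B /\ restriction B A.

Definition everywhere T := Operator setT T.

Definition opcomp A B :=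
  Operator [set u | opdom B u /\ opdom A (B u)] (fun u => A (B u)).

(* Meaningful when [A] is injective on its domain. *)
Definition opinv A :=
  Operator (oprange A) (fun f => xget 0 [set u | opdom A u /\ A u = f]).

(* Meaningful when [A] is closable. *)
Definition opclosure A :=
  Operator [set u | exists w, closure (opgraph A) (u, w)]
           (fun u => xget 0 [set w | closure (opgraph A) (u, w)]).

Definition closed_operator A := linear_operator A /\ closed (opgraph A).

Definition bounded_operator T :=
  exists2 C : R[i], 0 < C & forall x, `|T x| <= C * `|x|.

Definition correctly_solvable A :=
  linear_operator A /\
  exists2 C : R[i], 0 < C & forall u, opdom A u -> `|u| <= C * `|A u|.

Definition everywhere_solvable A := oprange A = setT.

Definition correct_operator A := correctly_solvable A /\ everywhere_solvable A.

Definition minimal_operator A := correctly_solvable A /\ closure (oprange A) <> setT.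

Definition maximal_operator A :=
  [/\ closed_operator A, oprange A = setT & opker A <> [set 0]].

Definition correct_extension A0 A := restriction A0 A /\ correct_operator A.

Definition correct_restriction B A := restriction A B /\ correct_operator A.

(* A form {dot H for conj} is linear in its first argument and conjugate-linear
   in the second. *)
Definition hilbert_inner (dot : {dot H for Num.conj}) :=
  forall x : H, dot x x = `|x| ^+ 2.

Section Adjoint.
Variable dot : {dot H for Num.conj}.

Definition adjoint_pair A (v w : H) :=
  forall u, opdom A u -> dot (A u) v = dot u w.

(* Meaningful when [A] is densely defined, so that [w] is determined by [v]. *)
Definition adjoint A :=
  Operator [set v | exists w, adjoint_pair A v w]
           (fun v => xget 0 [set w | adjoint_pair A v w]).

Definition symmetric_operator A :=
  [/\ linear_operator A, dense (opdom A) &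
      forall u v, opdom A u -> opdom A v -> dot (A u) v = dot u (A v)].

Definition selfadjoint_operator A :=
  [/\ linear_operator A, dense (opdom A) & opeq A (adjoint A)].

(* In R[i], [0 <= z] means that [z] is a nonnegative real number. *)
Definition nonnegative_operator T := forall x : H, 0 <= dot (T x) x.

End Adjoint.

Definition similar_operators A B :=
  exists S T : {linear H -> H},
    [/\ bounded_operator S, bounded_operator T, cancel S T, cancel T S &
        opeq A (opcomp (everywhere S) (opcomp B (everywhere T)))].

End Operators.

Arguments operator {R} H.

(* Main.v *)
Require Import Defs.
From HB Require Import structures.
From mathcomp Require Import all_boot all_order all_algebra.
From mathcomp Require Import complex ring lra.
From mathcomp Require Import boolp classical_sets reals topology normedtype.
From mathcomp Require Import sequences.

(** Let [G] be the inverse of [L], a bounded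
self-adjoint operator, and let [P] be the bounded extension of [K L].  Since
[K = P G], the inverse of [LK] is [G + K = (I + P) G].  The operator [I + P] is
self-adjoint and bounded below by [I], so it has a self-adjoint, boundedly
invertible square root [S], and [S S G = S (S G S) S^-1].  Hence [LK] is similar,
through [S], to the inverse of [S G S], that is to [S^-1 L S^-1], which is
self-adjoint because it is congruent to [L] ([selfadjoint_congruence]).

The operator [P] is obtained as [L K^*].  It is everywhere defined because the
range of [K^*] lies in the domain of [L], and it is a formal adjoint of [K L].
The existence of [K^*] is the Riesz representation theorem ([riesz]).  A densely
defined operator with an everywhere defined formal adjoint is closable, so the
positivity of the closure of [K L] is positivity of [K L] itself
([opclosure_val]); positivity on a complex space implies symmetry
([nonnegative_rsymmetric]), and a symmetric operator agrees with its formal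
adjoint on its domain.  So [P] does extend [K L], and the uniform boundedness
principle bounds it ([nonnegative_extension]).

The square root comes from the iteration [Y := (N + Y^2) / 2], whose fixed point
satisfies [(I - Y)^2 = I - N]; it converges geometrically as soon as the norm of
[N] is below 1 ([contraction_sqrt]), which holds after scaling [I + P]
([positive_sqrt]).

All estimates are made with the real part [rdot] of the inner product and the
real number [rnorm]: symmetry and duality over the reals give back the complex
statements by [dot_eq], and every limit in the proof is that of a geometric
estimate, so [geometric_limit] and [le_geometric] are the only facts about
convergence used below them. *)

Set Implicit Arguments.
Unset Strict Implicit.
Unset Printing Implicit Defensive.

Import Order.TTheory GRing.Theory Num.Theory.
Import numFieldNormedType.Exports.

Local Open Scope classical_set_scope.
Local Open Scope ring_scope.

(** * The norm with real values, and geometric convergence *)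

Section RealNorm.
Variables (R : realType) (H : completeNormedModType R[i]).
Implicit Types (x y z : H) (u : nat -> H).

(** The norm of [H] takes its values in [R[i]], whose order is only partial;
[rnorm] is the same norm with values in the ordered field [R]. *)
Definition rnorm (x : H) : R := complex.Re `|x|.

Lemma normE x : `|x| = (rnorm x)%:C%C.
Proof. by rewrite /rnorm RRe_real // ger0_real. Qed.

Lemma rnorm_ge0 x : 0 <= rnorm x.
Proof. by rewrite -ler0c -normE. Qed.

Lemma rnormD x y : rnorm (x + y) <= rnorm x + rnorm y.
Proof. by rewrite -lecR rmorphD /= -!normE ler_normD. Qed.

Lemma rnormN x : rnorm (- x) = rnorm x.
Proof. by rewrite /rnorm normrN. Qed.

Lemma rnormB x y : rnorm (x - y) = rnorm (y - x).
Proof. by rewrite -rnormN opprB. Qed.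

Lemma rnorm0 : rnorm 0 = 0.
Proof. by rewrite /rnorm normr0. Qed.

Lemma rnorm0_eq0 x : rnorm x <= 0 -> x = 0.
Proof.
move=> x0; apply/normr0_eq0; rewrite normE.
by have -> : rnorm x = 0 by apply/le_anti; rewrite x0 rnorm_ge0.
Qed.

Lemma rnormZ (t : R) x : rnorm (t%:C%C *: x) = `|t| * rnorm x.
Proof.
apply: (@complexI R); rewrite -normE normrZ normE rmorphM /=.
by rewrite normc_def /= expr0n addr0 sqrtr_sqr.
Qed.

Lemma rnormZc (a : R[i]) x : rnorm (a *: x) = complex.Re `|a| * rnorm x.
Proof.
have aE : `|a| = (complex.Re `|a|)%:C%C by rewrite RRe_real // ger0_real.
by apply: (@complexI R); rewrite -normE normrZ aE normE rmorphM.
Qed.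

Lemma rnormDle x y z : rnorm (x - z) <= rnorm (x - y) + rnorm (y - z).
Proof. by rewrite -{1}(subrK y x) -addrA rnormD. Qed.

Lemma bounded_operatorP (T : H -> H) : bounded_operator T <->
  exists2 c : R, 0 < c & forall x, rnorm (T x) <= c * rnorm x.
Proof.
split=> -[c c0 Tc].
  have cE : c = (complex.Re c)%:C%C by rewrite RRe_real // gtr0_real.
  exists (complex.Re c); first by rewrite -ltcR -cE.
  by move=> x; rewrite -lecR rmorphM /= -cE -!normE.
exists c%:C%C; first by rewrite ltcR.
by move=> x; rewrite !normE -rmorphM lecR.
Qed.

Lemma nbhs_rnormP x (A : set H) : nbhs x A <->
  exists2 e : R, 0 < e & forall y, rnorm (x - y) < e -> A y.
Proof.
split=> [/nbhs_ballP[e /= e0 eA]|[e e0 eA]].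
  have eE : e = (complex.Re e)%:C%C by rewrite RRe_real // gtr0_real.
  exists (complex.Re e); first by rewrite -ltcR -eE.
  move=> y xy; apply: eA; rewrite -ball_normE /ball_ /= normE eE.
  by rewrite ltcR.
apply/nbhs_ballP; exists e%:C%C; first by rewrite /= ltcR.
by move=> y; rewrite -ball_normE /ball_ /= normE ltcR; exact: eA.
Qed.

Lemma le_geometric (a b c r : R) : 0 <= r < 1 ->
  (forall n : nat, a <= b + c * r ^+ n) -> a <= b.
Proof.
move=> /andP[r0 r1] abc.
have lim_rhs : (fun n : nat => b + c * r ^+ n) @ \oo --> b + c * 0.
  apply: cvgD; first exact: cvg_cst.
  apply: cvgM; first exact: cvg_cst.
  by apply: cvg_expr; rewrite ger0_norm.
rewrite mulr0 addr0 in lim_rhs; apply: (cvgr_to_ge lim_rhs).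
by apply: nearW => n; exact: abc.
Qed.

Lemma geometric_lt (c r e : R) : 0 <= r < 1 -> 0 < e ->
  exists n : nat, c * r ^+ n < e.
Proof.
move=> r01 e0; apply: contrapT => /forallNP cn.
suff : e <= 0 by rewrite leNgt e0.
apply: (@le_geometric e 0 c r r01) => n.
by rewrite add0r leNgt; apply/negP; exact: cn.
Qed.

(** The form in which completeness of [H] is used.  The constant is the sum of
the tail of the geometric series, obtained by telescoping. *)
Lemma geometric_limit u (c r : R) : 0 <= r < 1 ->
  (forall n, rnorm (u n.+1 - u n) <= c * r ^+ n) ->
  exists l, forall n, rnorm (l - u n) <= c / (1 - r) * r ^+ n.
Proof.
move=> r01 step; have /andP[r0 r1] := r01.
set d := c / (1 - r).
have r1N0 : 1 - r != 0 by rewrite subr_eq0 eq_sym lt_eqF.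
have c0 : 0 <= c.
  by have := step 0; rewrite mulr1; apply: le_trans (rnorm_ge0 _).
have d0 : 0 <= d by rewrite divr_ge0 // subr_ge0 ltW.
have tele m k : rnorm (u (m + k)%N - u m) <= d * (r ^+ m - r ^+ (m + k)%N).
  elim: k => [|k IHk]; first by rewrite addn0 !subrr rnorm0 mulr0.
  rewrite addnS (le_trans (rnormDle _ (u (m + k)%N) _)) //.
  rewrite (le_trans (lerD (step _) IHk)) // exprS.
  by rewrite le_eqVlt; apply/orP; left; apply/eqP; rewrite /d; field.
have tail m n : (m <= n)%N -> rnorm (u n - u m) <= d * r ^+ m.
  move=> /subnKC <-; apply: le_trans (tele _ _) _.
  by rewrite ler_wpM2l // gerBl exprn_ge0.
have /cauchy_cvg : cauchy (u @ \oo).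
  apply/cauchyP => e e0.
  have eE : e = (complex.Re e)%:C%C by rewrite RRe_real // gtr0_real.
  have [n dn] : exists n : nat, d * r ^+ n < complex.Re e.
    by apply: geometric_lt => //; rewrite -ltcR -eE.
  exists (u n); exists n => // m /= nm; rewrite -ball_normE /ball_ /=.
  by rewrite normE eE ltcR rnormB (le_lt_trans (tail _ _ nm)).
move=> /cvg_ex[l ul]; exists l => n.
apply/ler_addgt0Pr => e e0.
have : nbhs l [set y | rnorm (l - y) < e] by apply/nbhs_rnormP; exists e.
move=> /ul[m _ /(_ (maxn m n) (leq_maxl _ _)) /= lm].
rewrite (le_trans (rnormDle _ (u (maxn m n)) _)) // addrC.
by rewrite lerD // ?tail ?leq_maxr // ltW.
Qed.


End RealNorm.

(** * The real inner product *)

Section RealInner.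
Variables (R : realType) (H : completeNormedModType R[i]).
Variables (dot : {dot H for Num.conj}) (dotE : hilbert_inner dot).
Implicit Types (x y z : H) (D : set H).

Definition rdot (x y : H) : R := complex.Re (dot x y).

Lemma ReD (a b : R[i]) : complex.Re (a + b) = complex.Re a + complex.Re b.
Proof. by case: a b => [? ?] [? ?]. Qed.

Lemma ReN (a : R[i]) : complex.Re (- a) = - complex.Re a.
Proof. by case: a. Qed.

Lemma rdotxx x : rdot x x = rnorm x ^+ 2.
Proof. by rewrite /rdot dotE normE -rmorphXn. Qed.

Lemma dotC x y : dot x y = (dot y x)^*%C.
Proof. by have := hermC dot x y; rewrite expr0 mul1r => ->. Qed.

Lemma rdotC x y : rdot x y = rdot y x.
Proof. by rewrite /rdot dotC; case: (dot y x). Qed.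

Lemma rdotDl x y z : rdot (x + y) z = rdot x z + rdot y z.
Proof. by rewrite /rdot linearDl ReD. Qed.

Lemma rdotNl x z : rdot (- x) z = - rdot x z.
Proof. by rewrite /rdot linearNl ReN. Qed.

Lemma rdotBl x y z : rdot (x - y) z = rdot x z - rdot y z.
Proof. by rewrite rdotDl rdotNl. Qed.

Lemma rdotZl (t : R) x z : rdot (t%:C%C *: x) z = t * rdot x z.
Proof.
rewrite /rdot linearZl_LR /=; case: (dot x z) => a b /=.
by rewrite mul0r subr0.
Qed.

Lemma rdotDr x y z : rdot z (x + y) = rdot z x + rdot z y.
Proof. by rewrite rdotC rdotDl !(rdotC z). Qed.

Lemma rdotNr x z : rdot z (- x) = - rdot z x.
Proof. by rewrite rdotC rdotNl (rdotC z). Qed.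

Lemma rdotBr x y z : rdot z (x - y) = rdot z x - rdot z y.
Proof. by rewrite rdotDr rdotNr. Qed.

Lemma rdotZr (t : R) x z : rdot z (t%:C%C *: x) = t * rdot z x.
Proof. by rewrite rdotC rdotZl (rdotC z). Qed.

Lemma rdot_iZl x y : rdot ('i%C *: x) y = - complex.Im (dot x y).
Proof.
rewrite /rdot linearZl_LR /=; case: (dot x y) => a b /=.
by rewrite mul0r mul1r add0r.
Qed.

(** Rotating a vector by ['i] turns the imaginary part of [dot] into its real
part; this is how complex identities are recovered from real ones. *)
Lemma dot_eq x y x' y' : rdot x y = rdot x' y' ->
  rdot ('i%C *: x) y = rdot ('i%C *: x') y' -> dot x y = dot x' y'.
Proof.
rewrite !rdot_iZl /rdot => re /oppr_inj im.
by apply/eqP; rewrite eq_complex re im !eqxx.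
Qed.

(** For a complex-linear [T] this is the usual symmetry with respect to [dot]
([rsymmetric_dot]). *)
Definition rsymmetric (T : H -> H) := forall x y, rdot (T x) y = rdot x (T y).

Lemma sqr_rnormDZ x y (t : R) :
  rnorm (x + t%:C%C *: y) ^+ 2
    = rnorm x ^+ 2 + t * rdot x y *+ 2 + t ^+ 2 * rnorm y ^+ 2.
Proof.
rewrite -!rdotxx !rdotDl !rdotDr !rdotZl !rdotZr (rdotC y x); ring.
Qed.

(** Evaluation at the minimum [- b / a] gives the bound; when [a = 0] the
polynomial is affine, and nonnegative only if it is constant. *)
Lemma discriminant_le0 (a b c : R) : 0 <= a ->
  (forall t : R, 0 <= c + t * b *+ 2 + t ^+ 2 * a) -> b ^+ 2 <= a * c.
Proof.
move=> a0 q.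
have [a_eq0|aN0] := eqVneq a 0.
  have -> : b = 0.
    apply/eqP; apply: contrapT => /negP b0.
    have := q (- (c + 1) / (b *+ 2)); rewrite a_eq0.
    have -> : c + - (c + 1) / (b *+ 2) * b *+ 2
      + (- (c + 1) / (b *+ 2)) ^+ 2 * 0 = -1 by field.
    lra.
  by rewrite a_eq0 expr0n mul0r.
have agt0 : 0 < a by rewrite lt_def aN0.
have := q (- b / a).
have -> : c + - b / a * b *+ 2 + (- b / a) ^+ 2 * a = c - b ^+ 2 / a by field.
by rewrite subr_ge0 ler_pdivrMr // mulrC.
Qed.

Lemma rdot_le x y : `|rdot x y| <= rnorm x * rnorm y.
Proof.
rewrite -ler_sqr ?nnegrE ?mulr_ge0 ?rnorm_ge0 // real_normK ?num_real //.
rewrite exprMn mulrC; apply: discriminant_le0 => [|t]; first exact: sqr_ge0.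
by rewrite -sqr_rnormDZ sqr_ge0.
Qed.

Lemma rnorm_le_dual x (c : R) : 0 <= c ->
  (forall y, rdot x y <= c * rnorm y) -> rnorm x <= c.
Proof.
move=> c0 xc; have := xc x; rewrite rdotxx expr2.
have := rnorm_ge0 x; rewrite le_eqVlt => /orP[/eqP <- //|x0].
by rewrite ler_pM2r.
Qed.

Lemma denseP D : dense D <->
  forall x (e : R), 0 < e -> exists2 y, D y & rnorm (x - y) < e.
Proof.
split=> [Dd x e e0|Dd O [x Ox] Oopen].
  have [||y [xy Dy]] := Dd [set y | rnorm (x - y) < e]; last by exists y.
  - by exists x; rewrite /= subrr rnorm0.
  - rewrite openE => y /= xy; apply/nbhs_rnormP.
    exists (e - rnorm (x - y)); first by rewrite subr_gt0.
    by move=> z yz /=; rewrite (le_lt_trans (rnormDle _ y _)) // -ltrBrDl.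
have /nbhs_rnormP[e e0 eO] : nbhs x O by apply: open_nbhs_nbhs.
by have [y Dy xy] := Dd x e e0; exists y; split=> //; exact: eO.
Qed.

Lemma rdot_dense_inj D x : dense D -> (forall y, D y -> rdot y x = 0) -> x = 0.
Proof.
move=> /denseP Dd Dx; apply: rnorm0_eq0; apply/ler_addgt0Pr => e e0.
rewrite add0r; have [y Dy xy] := Dd x e e0.
have : rnorm x ^+ 2 <= rnorm (x - y) * rnorm x.
  rewrite -rdotxx -[X in rdot X _](subrK y) rdotDl (Dx y) // addr0.
  by rewrite (le_trans (ler_norm _)) // rdot_le.
have := rnorm_ge0 x; rewrite le_eqVlt => /orP[/eqP <-|x0].
  by move=> _; exact: ltW.
by rewrite expr2 ler_pM2r // => /le_trans; apply; exact: ltW.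
Qed.

End RealInner.

(** * Riesz representation and uniform boundedness *)

Section Duality.
Variables (R : realType) (H : completeNormedModType R[i]).
Variables (dot : {dot H for Num.conj}) (dotE : hilbert_inner dot).
Implicit Types (x y z : H) (D : set H).
Local Notation rdot := (rdot dot).

(** The vector representing [f] is the minimiser of [J x = |x|^2 / 2 - f x].  A
point whose [J] is within [d^2 / 2] of the infimum represents [f] up to [d], by
the discriminant bound on lines through it; two such points are therefore close
to each other, which makes a minimising sequence converge without any
parallelogram identity. *)
Lemma riesz (f : H -> R) (c : R) : 0 <= c ->
  {morph f : x y / x + y} -> (forall (t : R) x, f (t%:C%C *: x) = t * f x) ->
  (forall x, `|f x| <= c * rnorm x) -> exists u, forall h, f h = rdot u h.
Proof.
move=> c0 fD fZ f_le.
pose J x := rnorm x ^+ 2 / 2 - f x.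
have J_inf : has_inf (range J).
  split; first by exists (J 0); exists 0.
  exists (- (c ^+ 2 / 2)) => _ [x _ <-]; rewrite /J.
  have := le_trans (ler_norm _) (f_le x); have := sqr_ge0 (rnorm x - c); nra.
have almost (d : R) : 0 < d ->
    exists x, forall h, `|rdot x h - f h| <= d * rnorm h.
  move=> d0; have [|_ [x _ <-] Jx] := inf_adherent (_ : 0 < d ^+ 2 / 2) J_inf.
    by rewrite divr_gt0 ?exprn_gt0.
  exists x => h.
  rewrite -ler_sqr ?nnegrE ?mulr_ge0 ?rnorm_ge0 ?(ltW d0) //.
  rewrite real_normK ?num_real // exprMn mulrC.
  apply: discriminant_le0 => [|t]; first exact: sqr_ge0.
  have JxJ : J x <= J (x + t%:C%C *: h) + d ^+ 2 / 2.
    rewrite (le_trans (ltW Jx)) // lerD2r; apply: ge_inf; first by case: J_inf.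
    by exists (x + t%:C%C *: h).
  move: JxJ; rewrite /J (sqr_rnormDZ dotE) fD fZ; lra.
have half01 : 0 <= (2^-1 : R) < 1 by lra.
have geom0 n : 0 < (2^-1 : R) ^+ n by rewrite exprn_gt0 // invr_gt0.
have [x xf] := choice (fun n => almost _ (geom0 n)).
have [|l xl] := @geometric_limit R H x 2 2^-1 half01.
  move=> n; apply: (rnorm_le_dual dotE) => [|h].
    by rewrite mulr_ge0 // ltW.
  rewrite rdotBl; have := xf n h; have := xf n.+1 h.
  rewrite exprS !ler_norml; have := geom0 n; have := rnorm_ge0 h.
  set g := 2^-1 ^+ n; set N := rnorm h => *; have : 0 <= g * N by nra.
  nra.
exists l => h; apply/eqP; rewrite eq_sym -subr_eq0 -normr_le0.
apply: (@le_geometric R _ _ (5 * rnorm h) 2^-1 half01) => n.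
have := xf n h; have := rdot_le dotE (l - x n) h.
have := ler_pM (rnorm_ge0 _) (rnorm_ge0 h) (xl n) (lexx _).
rewrite rdotBl add0r.
have -> : (2 / (1 - 2^-1) : R) = 4 by field.
rewrite !ler_norml; set N := rnorm h; set g := 2^-1 ^+ n; lra.
Qed.

Lemma bounded_adjoint (T : {linear H -> H}) : bounded_operator T ->
  forall y, exists z, forall x, dot (T x) y = dot x z.
Proof.
move=> /bounded_operatorP[c c0 Tc] y.
have [||||z Tz] := @riesz (fun x => rdot (T x) y) (c * rnorm y).
- by rewrite mulr_ge0 ?rnorm_ge0 ?ltW.
- by move=> x x'; rewrite linearD rdotDl.
- by move=> t x; rewrite linearZ rdotZl.
- move=> x; rewrite (le_trans (rdot_le dotE _ _)) // mulrAC.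
  by rewrite ler_wpM2r ?rnorm_ge0.
- exists z => x; apply: dot_eq; first by rewrite Tz rdotC.
  by rewrite -linearZ Tz rdotC.
Qed.

(** The values at [x + h] and [x - h] of a functional cannot both be smaller in
absolute value than its value at [h]; take for [h] the multiple of [z] of norm
[r]. *)
Lemma hump z x (r : R) : 0 <= r ->
  exists2 y, rnorm (y - x) <= r & r * rnorm z <= `|rdot z y|.
Proof.
move=> r0; have := rnorm_ge0 z; rewrite le_eqVlt => /orP[/eqP z0|z0].
  by exists x; rewrite ?subrr ?rnorm0 // -z0 mulr0.
pose h := (r / rnorm z)%:C%C *: z.
have hr : rnorm h = r.
  by rewrite rnormZ ger0_norm ?divr_ge0 ?rnorm_ge0 // divfK ?gt_eqF.
have zh : rdot z h = r * rnorm z.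
  by rewrite rdotZr (rdotxx dotE); field; rewrite gt_eqF.
have [xz|xz] := lerP 0 (rdot z x).
  exists (x + h); first by rewrite addrC addKr hr.
  by rewrite rdotDr zh (le_trans _ (ler_norm _)) // lerDr.
exists (x - h); first by rewrite addrC addKr rnormN hr.
by rewrite rdotBr zh -normrN (le_trans _ (ler_norm _)) // opprB lerBrDr; lra.
Qed.

(** Gliding hump, after Sokal: if [Z] is unbounded, pick [z n] in [Z] of norm at
least [n 3^n], and move from [u n] to [u n.+1] by at most [3^-n] so as to make the
[n]th functional at least [3^-n |z n|].  All later moves add up to at most
[3^-n / 2], so at the limit the [n]th functional is still at least [n / 2], which
contradicts pointwise boundedness there. *)
Lemma uniform_boundedness (Z : set H) :
  (forall y, exists c : R, forall z, Z z -> `|rdot z y| <= c) ->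
  exists2 c : R, 0 < c & forall z, Z z -> rnorm z <= c.
Proof.
move=> Zpt; apply: contrapT => Zunb.
have big (n : nat) : exists z, Z z /\ n%:R * 3 ^+ n <= rnorm z.
  apply: contrapT => /forallNP noz; apply: Zunb.
  exists (n%:R * 3 ^+ n + 1).
    by rewrite ltr_wpDl // mulr_ge0 // exprn_ge0.
  move=> z Zz; have /not_andP[//|/negP] := noz z.
  by rewrite -ltNge => /ltW /le_trans; apply; rewrite lerDl.
have [z zP] := choice big.
have third01 : 0 <= (3^-1 : R) < 1 by lra.
have geom0 n : 0 < (3^-1 : R) ^+ n by rewrite exprn_gt0 // invr_gt0.
have next (nx : nat * H) : exists y, rnorm (y - nx.2) <= 3^-1 ^+ nx.1 /\
    3^-1 ^+ nx.1 * rnorm (z nx.1) <= `|rdot (z nx.1) y|.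
  by have [y ? ?] := hump (z nx.1) nx.2 (ltW (geom0 nx.1)); exists y.
have [step stepP] := choice next.
pose u := fix u n := if n is m.+1 then step (m, u m) else 0.
have [|l ul] := @geometric_limit R H u 1 3^-1 third01.
  by move=> n; rewrite mul1r; have [] := stepP (n, u n).
have [c zlc] := Zpt l.
have lower n : n%:R <= 2 * c.
  have [Zz z_big] := zP n.
  have [_ /=] := stepP (n, u n); rewrite -[step _]/(u n.+1) => hump_n.
  have := rdot_le dotE (z n) (l - u n.+1).
  have := ler_wpM2l (rnorm_ge0 (z n)) (ul n.+1).
  have -> : 1 / (1 - 3^-1) * 3^-1 ^+ n.+1 = 3^-1 ^+ n / 2 :> R.
    by rewrite exprS; field.
  have : n%:R <= 3^-1 ^+ n * rnorm (z n).
    by rewrite exprVn mulrC ler_pdivlMr // exprn_gt0.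
  have := zlc _ Zz; rewrite rdotBr.
  have := ler_normB (rdot (z n) l) (rdot (z n) l - rdot (z n) (u n.+1)).
  rewrite subKr mulrA [rnorm (z n) * _]mulrC.
  lra.
have c0 : 0 <= 2 * c by have := lower 0.
by have := archi_boundP c0; rewrite ltNge lower.
Qed.

End Duality.

(** * Square roots of positive operators *)

Section SquareRoot.
Variables (R : realType) (H : completeNormedModType R[i]).
Variables (dot : {dot H for Num.conj}) (dotE : hilbert_inner dot).
Implicit Types (x y z : H) (D : set H).
Local Notation rdot := (rdot dot).
Local Notation rsymmetric := (rsymmetric dot).

Lemma linear_bundle (f : H -> H) : linear f ->
  exists F : {linear H -> H}, F =1 f.
Proof.
move=> fL; pose lin := GRing.isLinear.Build R[i] H H *:%R f fL.
pose F : {linear H -> H} := HB.pack f lin.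
by exists F.
Qed.

(** Neumann series: the iteration [x := y + Y x] is a contraction. *)
Lemma neumann (Y : {linear H -> H}) (r : R) : 0 <= r < 1 ->
  (forall x, rnorm (Y x) <= r * rnorm x) -> forall y, exists x, x - Y x = y.
Proof.
move=> r01 Yr y; have /andP[r0 r1] := r01.
pose u := fix u n := if n is m.+1 then y + Y (u m) else 0.
have uS n : u n.+1 = y + Y (u n) by [].
have [|l ul] := @geometric_limit R H u (rnorm y) r r01.
  elim=> [|n IHn]; first by rewrite uS linear0 addr0 subr0 mulr1.
  rewrite !uS opprD addrACA subrr add0r -linearB.
  by rewrite (le_trans (Yr _)) // exprS mulrCA ler_wpM2l.
exists l; apply/eqP; rewrite -subr_eq0; apply/eqP/rnorm0_eq0.
set c := _ / _ in ul.
apply: (@le_geometric R _ _ (c + c) r r01) => n; rewrite add0r.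
have -> : l - Y l - y = (l - u n.+1) - Y (l - u n).
  by rewrite uS linearB opprB opprD !addrA addrNK -!addrA [- Y l - y]addrC.
rewrite (le_trans (rnormD _ _)) // rnormN mulrDl lerD //.
  rewrite (le_trans (ul _)) // exprS.
  have := le_trans (rnorm_ge0 _) (ul n); nra.
rewrite (le_trans (Yr _)) //; have := ul n; have := rnorm_ge0 (l - u n); nra.
Qed.

(** In terms of [r = 1 - d], the bound on [N] is [2 r - r^2]; this is exactly
what makes the ball of radius [r] stable under [Y := (N + Y^2) / 2], and on that
ball the iteration contracts by the factor [r].  The last conclusion says that
[(I - Y)^2 = I - N]. *)
Lemma contraction_sqrt (N : {linear H -> H}) (d : R) : 0 < d <= 1 ->
  rsymmetric N -> (forall x, rnorm (N x) <= (1 - d ^+ 2) * rnorm x) ->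
  exists Y : {linear H -> H}, [/\ rsymmetric Y,
    forall x, rnorm (Y x) <= (1 - d) * rnorm x &
    forall x, Y x + Y x = N x + Y (Y x)].
Proof.
move=> /andP[d0 d1] Nsym Nle; pose r := 1 - d.
have r01 : 0 <= r < 1 by rewrite /r; lra.
have /andP[r0 r1] := r01.
pose h : R := 2^-1.
pose A := fix A n := if n is m.+1 then fun x => h%:C%C *: (N x + A m (A m x))
  else fun=> 0 : H.
have AS n x : A n.+1 x = h%:C%C *: (N x + A n (A n x)) by [].
have Alin n : linear (A n).
  elim: n => [|n IHn] a x y; first by rewrite /= scaler0 addr0.
  rewrite !AS linearP !IHn scalerA [a * _]mulrC -scalerA -scalerDr.
  by rewrite addrACA -scalerDr.
have AB n x y : A n (x - y) = A n x - A n y.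
  by move: (Alin n (-1) y x); rewrite !scaleN1r ![- _ + _]addrC.
have Asym n : rsymmetric (A n).
  elim: n => [|n IHn] x y.
    by rewrite /= -(scale0r (0 : H)) rdotZl rdotZr !mul0r.
  by rewrite !AS rdotZl rdotZr rdotDl rdotDr Nsym !IHn.
have Ale n x : rnorm (A n x) <= r * rnorm x.
  elim: n x => [|n IHn] x; first by rewrite /= rnorm0 mulr_ge0 ?rnorm_ge0.
  rewrite AS rnormZ ger0_norm ?invr_ge0 //.
  have := rnormD (N x) (A n (A n x)); have := Nle x; have := IHn x.
  have := IHn (A n x); rewrite /r /h in r0 *.
  have := rnorm_ge0 x; nra.
have Astep n x : rnorm (A n.+1 x - A n x) <= rnorm x * r ^+ n.
  elim: n x => [|n IHn] x.
    rewrite subr0 mulr1 (le_trans (Ale 1%N x)) //.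
    by have := rnorm_ge0 x; rewrite /r; nra.
  have -> : A n.+2 x - A n.+1 x =
      h%:C%C *: (A n.+1 (A n.+1 x - A n x) + (A n.+1 (A n x) - A n (A n x))).
    rewrite AB addrA subrK.
    rewrite [in LHS]AS [A n.+1 x in X in _ - X]AS -scalerBr.
    by rewrite opprD addrACA subrr add0r.
  rewrite rnormZ ger0_norm ?invr_ge0 // exprS.
  have := rnormD (A n.+1 (A n.+1 x - A n x)) (A n.+1 (A n x) - A n (A n x)).
  have := Ale n.+1 (A n.+1 x - A n x); have := IHn (A n x); have := IHn x.
  have := Ale n x; rewrite /h.
  have g0 : 0 <= r ^+ n by rewrite exprn_ge0.
  have := ler_wpM2l r0 (IHn x); have := ler_wpM2r g0 (Ale n x).
  set g := r ^+ n; lra.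
have lim x : exists l, forall n, rnorm (l - A n x) <= rnorm x / d * r ^+ n.
  have [l] := geometric_limit r01 (fun n => Astep n x).
  by rewrite [1 - r]subKr; exists l.
have [f fA] := choice lim.
have c0 x : 0 <= rnorm x / d by rewrite divr_ge0 ?rnorm_ge0 // ltW.
have f_unique x y (c : R) :
    (forall n, rnorm (y - A n x) <= c * r ^+ n) -> f x = y.
  move=> yA; apply/eqP; rewrite -subr_eq0; apply/eqP/rnorm0_eq0.
  apply: (@le_geometric R _ _ (rnorm x / d + c) r r01) => n.
  rewrite add0r mulrDl (le_trans (rnormDle _ (A n x) _)) //.
  by rewrite lerD ?fA // rnormB.
have [|Y Yf] := @linear_bundle f.
  move=> a x y.
  apply: (@f_unique _ _ (complex.Re `|a| * (rnorm x / d) + rnorm y / d)) => n.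
  have -> : a *: f x + f y - A n (a *: x + y)
      = a *: (f x - A n x) + (f y - A n y).
    by rewrite Alin scalerBr opprD addrACA.
  rewrite (le_trans (rnormD _ _)) // mulrDl lerD // rnormZc -mulrA ler_wpM2l //.
  by rewrite -ler0c RRe_real ?ger0_real.
have YA x n : rnorm (Y x - A n x) <= rnorm x / d * r ^+ n by rewrite Yf.
have Yle x : rnorm (Y x) <= r * rnorm x.
  apply: (@le_geometric R _ _ (rnorm x / d) r r01) => n.
  have := rnormD (Y x - A n x) (A n x); rewrite subrK => /le_trans; apply.
  by rewrite addrC lerD.
exists Y; split=> //.
  move=> x y; apply/eqP; rewrite -subr_eq0 -normr_le0.
  apply: (@le_geometric R _ _ (rnorm x / d * rnorm y + rnorm x * (rnorm y / d))
    r r01) => n.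
  have -> : rdot (Y x) y - rdot x (Y y)
      = rdot (Y x - A n x) y - rdot x (Y y - A n y).
    by rewrite rdotBl rdotBr Asym; ring.
  rewrite add0r (le_trans (ler_normB _ _)) // mulrDl lerD //.
    by rewrite (le_trans (rdot_le dotE _ _)) // mulrAC ler_wpM2r ?rnorm_ge0.
  by rewrite (le_trans (rdot_le dotE _ _)) // -mulrA ler_wpM2l ?rnorm_ge0.
move=> x; apply/eqP; rewrite -subr_eq0; apply/eqP/rnorm0_eq0.
apply: (@le_geometric R _ _ (4 * (rnorm x / d)) r r01) => n.
have -> : Y x + Y x - (N x + Y (Y x)) =
    ((Y x - A n.+1 x) + (Y x - A n.+1 x))
      - (A n (Y x - A n x) + (Y (Y x) - A n (Y x))).
  have hh : A n.+1 x + A n.+1 x = N x + A n (A n x).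
    rewrite AS -scalerDl -rmorphD /= /h [_ + _](_ : _ = 1) ?scale1r //.
    by field.
  rewrite AB addrACA -opprD hh [RHS]addrAC.
  rewrite [_ - _ + (_ - _)]addrC addrA subrK -[RHS]addrA -opprD.
  by rewrite addrCA subrK.
rewrite add0r (le_trans (rnormD _ _)) // rnormN.
have := rnormD (Y x - A n.+1 x) (Y x - A n.+1 x).
have := rnormD (A n (Y x - A n x)) (Y (Y x) - A n (Y x)).
have := Ale n (Y x - A n x); have := YA x n; have := YA x n.+1.
have : rnorm (Y (Y x) - A n (Y x)) <= rnorm x / d * r ^+ n.
  rewrite (le_trans (YA _ _)) // ler_wpM2r ?exprn_ge0 //.
  rewrite ler_wpM2r ?invr_ge0 ?(ltW d0) //.
  by rewrite (le_trans (Yle _)) // ler_piMl ?rnorm_ge0 // ltW.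
rewrite exprS; have g0 : 0 <= r ^+ n by rewrite exprn_ge0.
have cg0 := mulr_ge0 (c0 x) g0.
have := ler_piMl cg0 (ltW r1).
have := ler_piMl (rnorm_ge0 (Y x - A n x)) (ltW r1).
rewrite [_ * (r * _)]mulrCA; lra.
Qed.
(** Write [P = a^2 (I - N)].  Expanding [|x - P x / a^2|^2] and using both bounds
on [P] gives [|N x|^2 <= (1 - a^-2) |x|^2], so that [contraction_sqrt] applies with
[d = 1 / (2 a)], and [S = a (I - Y)].  As [|Y| <= 1 - d], [S] is bounded below by
[a d = 1 / 2], and onto by [neumann]. *)
Lemma positive_sqrt (P : {linear H -> H}) (a : R) : 1 <= a -> rsymmetric P ->
  (forall x, rnorm x ^+ 2 <= rdot (P x) x) ->
  (forall x, rnorm (P x) <= a * rnorm x) ->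
  exists S T : {linear H -> H},
    [/\ bounded_operator S, bounded_operator T, cancel S T & cancel T S] /\
    rsymmetric S /\ (forall x, S (S x) = P x).
Proof.
move=> a1 Psym Pge Ple; have a0 : 0 < a by lra.
have aN0 : a != 0 by rewrite gt_eqF.
pose d := (a * 2)^-1; pose b := a^-1 ^+ 2.
have da : d * a = 2^-1 by rewrite /d; field.
have d0 : 0 < d by rewrite invr_gt0; lra.
have d1 : d <= 1 by rewrite -(ler_pM2r a0); lra.
have bE : b = 4 * d ^+ 2 by rewrite /b /d; field.
have b0 : 0 <= b by rewrite sqr_ge0.
have [|N NE] := @linear_bundle (fun x => x - b%:C%C *: P x).
  move=> t x y.
  by rewrite linearP scalerDr opprD addrACA scalerBr !scalerA [t * _]mulrC.
have Nsym : rsymmetric N.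
  by move=> x y; rewrite !NE rdotBl rdotBr rdotZl rdotZr Psym.
have [||Y [Ysym Yle YE]] :=
  contraction_sqrt _ Nsym (_ : forall x, rnorm (N x) <= (1 - d ^+ 2) * rnorm x).
- by rewrite d0 d1.
- move=> x; have dd1 : d ^+ 2 <= 1 by rewrite expr_le1 // ltW.
  rewrite -ler_sqr ?nnegrE ?mulr_ge0 ?rnorm_ge0 ?subr_ge0 //.
  have -> : N x = x + (- b)%:C%C *: P x by rewrite NE rmorphN /= scaleNr.
  rewrite (sqr_rnormDZ dotE) rdotC exprMn.
  have : rnorm (P x) ^+ 2 <= a ^+ 2 * rnorm x ^+ 2.
    by rewrite -exprMn ler_sqr ?nnegrE ?mulr_ge0 ?rnorm_ge0 // ltW.
  have := Pge x.
  set q := rnorm x ^+ 2; set p := rdot _ _ => qp Pq.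
  have q0 : 0 <= q by exact: sqr_ge0.
  have bq : b * q <= b * p by rewrite ler_wpM2l.
  have := ler_wpM2l (sqr_ge0 b) Pq.
  have -> : b ^+ 2 * (a ^+ 2 * q) = b * q by rewrite /b; field.
  have := mulr_ge0 (sqr_ge0 (d ^+ 2)) q0.
  have := mulr_ge0 (sqr_ge0 d) q0.
  move: bq; rewrite bE; lra.
pose c := a%:C%C : R[i].
have cN0 : c != 0 by rewrite eq_complex /= eqxx andbT.
have [|S SE] := @linear_bundle (fun x => c *: (x - Y x)).
  move=> t x y.
  by rewrite linearP opprD addrACA -scalerBr scalerDr !scalerA [c * _]mulrC.
have S_le x : rnorm (S x) <= a * 2 * rnorm x.
  rewrite SE rnormZ gtr0_norm // -mulrA ler_pM2l //.
  have := rnormD x (- Y x); rewrite rnormN; have := Yle x.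
  have := mulr_ge0 (ltW d0) (rnorm_ge0 x); lra.
have S_ge x : rnorm x <= 2 * rnorm (S x).
  rewrite SE rnormZ gtr0_norm //.
  have := rnormD (x - Y x) (Y x); rewrite subrK.
  have := Yle x; set n := rnorm (x - Y x) => Yx xn.
  have : d * rnorm x <= n by lra.
  rewrite -(ler_pM2l a0) mulrA [a * d]mulrC da; lra.
have r01 : 0 <= 1 - d < 1 by lra.
have S_surj y : exists x, S x = y.
  have [x xE] := neumann r01 Yle (c^-1 *: y).
  by exists x; rewrite SE xE scalerA divff // scale1r.
have [t tK] := choice S_surj.
have S_inj x y : S x = S y -> x = y.
  move=> xy; apply/eqP; rewrite -subr_eq0; apply/eqP/rnorm0_eq0.
  by rewrite (le_trans (S_ge _)) // linearB xy subrr rnorm0 mulr0.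
have [|T TE] := @linear_bundle t.
  by move=> k x y; apply: S_inj; rewrite linearP !tK.
have TK : cancel T S by move=> x; rewrite TE tK.
have SK : cancel S T by move=> x; apply: S_inj; rewrite TK.
exists S, T; split; split=> //.
- by apply/bounded_operatorP; exists (a * 2) => //; rewrite mulr_gt0.
- by apply/bounded_operatorP; exists 2 => // x; rewrite -{2}(TK x).
- by move=> x y; rewrite !SE rdotZl rdotZr rdotBl rdotBr Ysym.
- move=> x; rewrite !SE linearZ /= -scalerBr scalerA (linearB Y).
  have -> : x - Y x - (Y x - Y (Y x)) = b%:C%C *: P x.
    rewrite opprB addrCA -[x - _ - _]addrA -opprD YE addrCA
       opprD (addrCA _ (- N x)) subrr addr0.
    by rewrite NE subKr.
  rewrite scalerA -!rmorphM /= [_ * _ * _](_ : _ = 1) ?scale1r //.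
  by rewrite /b; field.
Qed.

End SquareRoot.

(** * Self-adjoint and nonnegative operators *)

Section SelfAdjoint.
Variables (R : realType) (H : completeNormedModType R[i]).
Variables (dot : {dot H for Num.conj}) (dotE : hilbert_inner dot).
Implicit Types (x y z u v w : H) (D : set H) (A : operator H).
Local Notation rdot := (rdot dot).
Local Notation rsymmetric := (rsymmetric dot).

Lemma adjoint_pair_sym A : selfadjoint_operator dot A ->
  forall u, opdom A u -> adjoint_pair dot A u (A u).
Proof.
move=> [_ _ [[subdom eqval] _]] u Au.
by rewrite (eqval _ Au); apply: xgetPex; exact: subdom.
Qed.

Lemma adjoint_pair_max A : selfadjoint_operator dot A ->
  forall v w, adjoint_pair dot A v w -> opdom A v /\ A v = w.
Proof.
move=> sA v w vw; have [_ Ad [_ [subdom _]]] := sA.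
have Av : opdom A v by apply: subdom; exists w.
split=> //; apply/eqP; rewrite -subr_eq0; apply/eqP.
apply: (rdot_dense_inj dotE Ad) => u Au.
by rewrite rdotBr /rdot -(adjoint_pair_sym sA Av) // -vw // subrr.
Qed.

(** Density makes the vector in the definition of the adjoint unique, so the
choice operator picks the expected value. *)
Lemma selfadjointI A : linear_operator A -> dense (opdom A) ->
  (forall u, opdom A u -> adjoint_pair dot A u (A u)) ->
  (forall v w, adjoint_pair dot A v w -> opdom A v) ->
  selfadjoint_operator dot A.
Proof.
move=> Al Ad Asym Amax.
have val u : opdom A u -> A u = adjoint dot A u.
  move=> Au; rewrite /adjoint /=; apply/eqP; rewrite -subr_eq0; apply/eqP.
  have pair := xgetPex 0 (ex_intro _ _ (Asym _ Au)).
  apply: (rdot_dense_inj dotE Ad) => x Ax.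
  by rewrite rdotBr /rdot -(Asym _ Au) // -pair // subrr.
split=> //; split; split=> [u Au|u Au].
- by exists (A u); exact: Asym.
- exact: val.
- by have [w] := Au; exact: Amax.
- by rewrite -val //; have [w] := Au; exact: Amax.
Qed.

Lemma rsymmetric_dot (T : {linear H -> H}) : rsymmetric T ->
  forall x y, dot (T x) y = dot x (T y).
Proof.
by move=> Tsym x y; apply: dot_eq; rewrite ?Tsym // -linearZ Tsym.
Qed.

(** One polarisation suffices: the diagonal values at [x], [y] and ['i y + x] are
real, and comparing imaginary parts leaves the real part of the symmetry. *)
Lemma nonnegative_rsymmetric A : linear_operator A ->
  (forall x, opdom A x -> 0 <= dot (A x) x) ->
  forall x y, opdom A x -> opdom A y -> rdot (A x) y = rdot (A y) x.
Proof.
move=> [_ Al] Age x y Ax Ay.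
have [Aiyx Aval] := Al 'i%C y x Ay Ax.
have := ger0_Im (Age _ Aiyx); have := ger0_Im (Age _ Ax).
have := ger0_Im (Age _ Ay).
rewrite Aval !linearDl !linearDr /= !linearZl_LR !linearZr_LR /= /rdot.
case: (dot (A x) x) => ? ?; case: (dot (A x) y) => ? ?.
case: (dot (A y) x) => ? ?; case: (dot (A y) y) => ? ? /=.
lra.
Qed.

End SelfAdjoint.

(** * Bounded extension of a nonnegative operator *)

Section Extension.
Variables (R : realType) (H : completeNormedModType R[i]).
Variables (dot : {dot H for Num.conj}) (dotE : hilbert_inner dot).
Implicit Types (x y z u v w : H) (D : set H) (A : operator H).
Local Notation rdot := (rdot dot).
Local Notation rsymmetric := (rsymmetric dot).

Lemma half01 : 0 <= (2^-1 : R) < 1.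
Proof. lra. Qed.

Lemma halfX_gt0 n : 0 < (2^-1 : R) ^+ n.
Proof. by rewrite exprn_gt0 // invr_gt0. Qed.

(** An everywhere defined formal adjoint makes [A] closable: any limit value of
[A] at [x] pairs with every [y] as [x] does with [P y], so [A x] is the only
one. *)
Lemma opclosure_val A (P : H -> H) x : opdom A x ->
  (forall u y, opdom A u -> rdot (A u) y = rdot u (P y)) -> opclosure A x = A x.
Proof.
move=> Ax AP; set w := opclosure A x.
have w_cl : closure (opgraph A) (x, w).
  have inh : exists w', closure (opgraph A) (x, w').
    by exists (A x); apply: subset_closure; exists x.
  exact: (xgetPex 0 inh).
apply/eqP; rewrite -subr_eq0; apply/eqP.
have denseT : dense [set: H] by move=> O [y Oy] _; exists y.
apply: (rdot_dense_inj dotE denseT) => y _.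
rewrite rdotC rdotBl AP //; apply/eqP; rewrite -normr_le0.
apply: (@le_geometric R _ _ (rnorm y + rnorm (P y)) _ half01) => n.
have [|_ [[u Au <-] [/= xu wu]]] := w_cl [set p | rnorm (x - p.1) < 2^-1 ^+ n /\
    rnorm (w - p.2) < 2^-1 ^+ n].
  exists ([set u | rnorm (x - u) < 2^-1 ^+ n],
      [set v | rnorm (w - v) < 2^-1 ^+ n]).
    by split=> /=; apply/nbhs_rnormP; exists (2^-1 ^+ n); rewrite ?halfX_gt0.
  by move=> [u v] [].
have -> : rdot w y - rdot x (P y) = rdot (w - A u) y - rdot (x - u) (P y).
  by rewrite !rdotBl AP //; ring.
rewrite add0r (le_trans (ler_normB _ _)) // mulrDl lerD //
  (le_trans (rdot_le dotE _ _)) //.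
  by rewrite mulrC ler_wpM2l ?rnorm_ge0 // ltW.
by rewrite mulrC ler_wpM2l ?rnorm_ge0 // ltW.
Qed.

(** [A] is symmetric, hence agrees with its formal adjoint [P] on its domain.  The
image under [A] of the unit ball of the domain is weakly bounded, since it pairs
with [y] within [|P y|]; so [A] is bounded, and the other properties pass from
[A] to [P] by density. *)
Lemma nonnegative_extension A (P : {linear H -> H}) : linear_operator A ->
  dense (opdom A) -> (forall x, opdom A x -> 0 <= dot (A x) x) ->
  (forall u y, opdom A u -> rdot (A u) y = rdot u (P y)) ->
  [/\ forall x, opdom A x -> A x = P x, bounded_operator P, rsymmetric P &
      forall x, 0 <= rdot (P x) x].
Proof.
move=> Al Ad Age AP.
have AE y : opdom A y -> A y = P y.
  move=> Ay; apply/eqP; rewrite -subr_eq0; apply/eqP.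
  apply: (rdot_dense_inj dotE Ad) => x Ax.
  by rewrite rdotBr -AP // (nonnegative_rsymmetric Al Age) // rdotC subrr.
have [c c0 unit_le] : exists2 c : R, 0 < c & forall z,
    [set A x | x in [set x | opdom A x /\ rnorm x <= 1]] z -> rnorm z <= c.
  apply: (uniform_boundedness dotE) => y; exists (rnorm (P y)).
  move=> _ [x [Ax x1] <-]; rewrite AP // (le_trans (rdot_le dotE _ _)) //.
  by rewrite ler_piMl ?rnorm_ge0.
have AP_le x : opdom A x -> rnorm (P x) <= c * rnorm x.
  move=> Ax; have := rnorm_ge0 x; rewrite le_eqVlt => /orP[/eqP x0|x0].
    have -> : x = 0 by apply: rnorm0_eq0; rewrite -x0.
    by rewrite linear0 rnorm0 mulr0.
  have [A0 Alin] := Al; have [] := Alin (rnorm x)^-1%:C%C x 0 Ax A0.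
  rewrite addr0 => Ax' _.
  have := unit_le (A ((rnorm x)^-1%:C%C *: x)); rewrite AE // linearZ /= rnormZ.
  rewrite ger0_norm ?invr_ge0 ?rnorm_ge0 // mulrC ler_pdivrMr //; apply.
  exists ((rnorm x)^-1%:C%C *: x); last by rewrite AE // linearZ.
  split=> //; rewrite rnormZ ger0_norm ?invr_ge0 ?rnorm_ge0 //.
  by rewrite mulVf // gt_eqF.
have P_le y : rnorm (P y) <= c * rnorm y.
  have := rnorm_ge0 (P y); rewrite le_eqVlt => /orP[/eqP <-|Py0].
    by rewrite mulr_ge0 ?rnorm_ge0 // ltW.
  rewrite -(ler_pM2r Py0) -expr2.
  apply: (@le_geometric R _ _ (rnorm (P y) + c * rnorm y) _ half01) => n.
  have /denseP /(_ (P y) _ (halfX_gt0 n))[x Ax] := Ad.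
  rewrite -(rdotxx dotE) -[X in rdot X _](subrK x) rdotDl -(AP x) // AE //.
  set g := 2^-1 ^+ n => xg.
  have := le_trans (ler_norm _) (rdot_le dotE (P y - x) (P y)).
  have := le_trans (ler_norm _) (rdot_le dotE (P x) y).
  have := ler_wpM2r (rnorm_ge0 y) (AP_le x Ax).
  have := ler_wpM2r (ltW Py0) (ltW xg).
  have : rnorm x <= rnorm (P y) + g.
    have := rnormD (P y) (x - P y); rewrite subrKC rnormB => /le_trans; apply.
    by rewrite lerD2l ltW.
  move=> /(ler_wpM2l (ltW c0)) /(ler_wpM2r (rnorm_ge0 y)).
  lra.
have Pb : bounded_operator P by apply/bounded_operatorP; exists c.
have Psym : rsymmetric P.
  (* The adjoint of P exists and agrees with P against the dense domain. *)
  move=> x y; have [z Pz] := bounded_adjoint dotE Pb y.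
  suff -> : P y = z by rewrite /rdot Pz.
  apply/eqP; rewrite -subr_eq0; apply/eqP.
  apply: (rdot_dense_inj dotE Ad) => u Au.
  by rewrite rdotBr -(AP u) // AE // /rdot Pz subrr.
split=> // x.
apply: (@le_geometric R _ _ (c * rnorm x + c * (rnorm x + 1)) _ half01) => n.
have /denseP /(_ x _ (halfX_gt0 n))[u Au] := Ad.
have g1 : 2^-1 ^+ n <= 1 :> R by rewrite exprn_ile1 //; lra.
have g0 := halfX_gt0 n; set g := 2^-1 ^+ n in g0 g1 * => xu.
have uu : 0 <= rdot (P u) u.
  by rewrite -AE // /rdot; have := Age u Au; rewrite lecE => /andP[].
have -> : rdot (P x) x = rdot (P u) u + rdot (P (x - u)) x + rdot (P u) (x - u).
  by rewrite linearB !rdotBl !rdotBr; ring.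
have ux : rnorm u <= rnorm x + 1.
  have := rnormD x (u - x); rewrite subrKC rnormB => /le_trans; apply.
  by rewrite lerD2l (le_trans (ltW xu)).
have bound v w (s t : R) : rnorm v <= s -> rnorm w <= t ->
    - (c * (s * t)) <= rdot (P v) w.
  move=> vs wt; have := rdot_le dotE (P v) w; rewrite ler_norml => /andP[+ _].
  apply: le_trans; rewrite lerN2 mulrA ler_pM ?rnorm_ge0 //.
  by rewrite (le_trans (P_le _)) // ler_pM2l.
have := bound _ _ _ _ (ltW xu) (lexx (rnorm x)).
have := bound _ _ _ _ ux (ltW xu).
lra.
Qed.

End Extension.

(** * Correct operators and similarity *)

Section Correct.
Variables (R : realType) (H : completeNormedModType R[i]).
Implicit Types (A : operator H).

Lemma correct_inj A : correctly_solvable A ->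
  forall u v, opdom A u -> opdom A v -> A u = A v -> u = v.
Proof.
move=> [[A0 Al] [c _ Ac]] u v Au Av uv.
have [Auv AuvE] := Al (-1) v u Av Au.
apply/eqP; rewrite -subr_eq0 -normr_le0 addrC -scaleN1r.
by rewrite (le_trans (Ac _ Auv)) // AuvE uv scaleN1r addNr normr0 mulr0.
Qed.

Lemma opinvK A : correct_operator A ->
  forall f, opdom A (opinv A f) /\ A (opinv A f) = f.
Proof.
move=> [_ Asurj] f; have : oprange A f by rewrite Asurj.
move=> [u Au uf]; have inh : exists v, opdom A v /\ A v = f by exists u.
exact: (xgetPex 0 inh).
Qed.

Lemma opvalK A : correct_operator A -> forall u, opdom A u -> opinv A (A u) = u.
Proof.
move=> Ac u Au; have [Av vE] := opinvK Ac (A u).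
by have [As _] := Ac; exact: (correct_inj As).
Qed.

(** With [T] the inverse of the symmetric operator [S], pairing [T A T] against
[S x] amounts to pairing [A] against [x]; so an adjoint pair [(v, w)] of [T A T]
gives the adjoint pair [(T v, S w)] of [A]. *)
Lemma selfadjoint_congruence (dot : {dot H for Num.conj}) A
    (S T : {linear H -> H}) :
  hilbert_inner dot -> selfadjoint_operator dot A -> rsymmetric dot S ->
  bounded_operator S -> cancel S T -> cancel T S ->
  selfadjoint_operator dot
    (Operator [set u | opdom A (T u)] (fun u => T (A (T u)))).
Proof.
move=> dotE sA Ssym Sb SK TK.
have [[A0 Al] Ad _] := sA.
have Sdot := rsymmetric_dot Ssym.
have Tdot x y : dot (T x) y = dot x (T y).
  by rewrite -{1}(TK y) -Sdot TK.
apply: (selfadjointI dotE).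
- split=> [|a u v Au Av] /=; first by rewrite /= linear0.
  have [Auv AuvE] := Al a _ _ Au Av.
  by rewrite linearP; split=> //; rewrite AuvE linearP.
- apply/denseP => x e e0; have /bounded_operatorP[c c0 Sc] := Sb.
  have ec0 : 0 < e / c by rewrite divr_gt0.
  have /denseP /(_ (T x) _ ec0)[y Ay xy] := Ad.
  exists (S y); first by rewrite /= SK.
  rewrite -{1}(TK x) -linearB (le_lt_trans (Sc _)) //.
  by rewrite mulrC -ltr_pdivlMr.
- move=> u Au x Ax /=.
  by rewrite Tdot (adjoint_pair_sym sA Au) // Tdot.
- move=> v w vw /=.
  have pair : adjoint_pair dot A (T v) (S w).
    move=> x Ax; rewrite -Tdot.
    have := vw (S x); rewrite /= SK => /(_ Ax) ->.
    by rewrite Sdot.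
  by have [] := adjoint_pair_max dotE sA pair.
Qed.

End Correct.

Theorem corollary1p3 (R : realType) (H : completeNormedModType R[i])
    (dot : {dot H for Num.conj}) (dotE : hilbert_inner dot)
    (L0 Lhat L LK : operator H) (K : {linear H -> H})
    (L0_symmetric : symmetric_operator dot L0) (L0_minimal : minimal_operator L0)
    (Lhat_adjoint : opeq Lhat (adjoint dot L0)) (Lhat_maximal : maximal_operator Lhat)
    (L_selfadjoint : selfadjoint_operator dot L) (L_correct : correct_extension L0 L)
    (LK_correct : correct_restriction Lhat LK)
    (K_bounded : bounded_operator K) (K_ker : range K `<=` opker Lhat)
    (LK_inv : forall f : H, opinv LK f = opinv L f + K f)
    (Kadj_dom : oprange (adjoint dot (everywhere K)) `<=` opdom L)
    (KL_ge0 : nonnegative_operator dot (opclosure (opcomp (everywhere K) L))) :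
  exists2 B : operator H, selfadjoint_operator dot B & similar_operators LK B.
Proof.
have [[L_0 L_lin] L_dense _] := L_selfadjoint.
have [_ L_corr] := L_correct; have [_ LK_corr] := LK_correct.
pose KL := opcomp (everywhere K) L.
have KL_dom u : opdom KL u = opdom L u.
  by rewrite /KL /=; apply/propext; split=> [[]|].
have KL_dense : dense (opdom KL).
  move=> O O0 Oo; have [u [Ou Lu]] := L_dense O O0 Oo.
  by exists u; split; rewrite ?KL_dom.
have KL_lin : linear_operator KL.
  split=> [|a u v]; rewrite !KL_dom // => Lu Lv.
  have [Luv LuvE] := L_lin a u v Lu Lv.
  by split=> //=; rewrite LuvE linearP.
pose Kadj := adjoint dot (everywhere K).
have KadjE x y : dot (K x) y = dot x (Kadj y).
  have [z Kz] := bounded_adjoint dotE K_bounded y.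
  have inh : exists z, adjoint_pair dot (everywhere K) y z.
    by exists z => u _; exact: Kz.
  exact: (xgetPex 0 inh).
have Kadj_L y : opdom L (Kadj y).
  apply: Kadj_dom; exists y => //.
  have [z Kz] := bounded_adjoint dotE K_bounded y.
  by exists z => u _; exact: Kz.
have KL_pair x y : opdom KL x -> dot (KL x) y = dot x (L (Kadj y)).
  by rewrite KL_dom => Lx; rewrite KadjE (adjoint_pair_sym L_selfadjoint).
(* This is the formal adjoint L K^* of K L. *)
have [|P PE] := @linear_bundle _ _ (fun y => L (Kadj y)).
  move=> a y z; apply/eqP; rewrite -subr_eq0; apply/eqP.
  apply: (rdot_dense_inj dotE KL_dense) => x Lx.
  rewrite rdotBr /rdot -KL_pair // !linearDr !linearZr_LR /=.
  by rewrite -!KL_pair // subrr.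
have KL_P u y : opdom KL u -> rdot dot (KL u) y = rdot dot u (P y).
  by move=> Lu; rewrite PE /rdot KL_pair.
have KL_pos x : opdom KL x -> 0 <= dot (KL x) x.
  by move=> Lx; rewrite -(opclosure_val dotE Lx KL_P); exact: KL_ge0.
have [KLE Pb Psym Ppos] :=
  nonnegative_extension dotE KL_lin KL_dense KL_pos KL_P.
have [|Q QE] := @linear_bundle _ _ (fun x => x + P x).
  by move=> a x y; rewrite linearP scalerDr addrACA.
have Qsym : rsymmetric dot Q.
  by move=> x y; rewrite !QE rdotDl rdotDr Psym.
have /bounded_operatorP[c c0 Pc] := Pb.
have [|x|x|S [T [[Sb Tb SK TK] [Ssym SS]]]] :=
  positive_sqrt dotE (_ : 1 <= 1 + c) Qsym.
- by rewrite lerDl ltW.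
- by rewrite QE rdotDl (rdotxx dotE) lerDl.
- by rewrite QE mulrDl mul1r (le_trans (rnormD _ _)) // lerD2l.
(* The inverse of LK is (I + P) L^-1, because K = K L L^-1 = P L^-1. *)
have LKinvE f : opinv LK f = S (S (opinv L f)).
  have [LG LGE] := opinvK L_corr f.
  by rewrite LK_inv SS QE -KLE ?KL_dom //= LGE.
exists (Operator [set u | opdom L (T u)] (fun u => T (L (T u)))).
  exact: (selfadjoint_congruence dotE L_selfadjoint Ssym Sb SK TK).
have LK_fwd u : opdom LK u -> opdom L (T (T u)) /\ L (T (T u)) = LK u.
  move=> LKu; have := LKinvE (LK u); rewrite opvalK // => {1 2}->.
  by rewrite !SK; exact: opinvK.
have LK_bwd u : opdom L (T (T u)) -> opdom LK u.
  move=> Lu; have := LKinvE (L (T (T u))); rewrite opvalK // !TK => <-.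
  by have [] := opinvK LK_corr (L (T (T u))).
exists S, T; split=> //; split; split=> u /=.
- by move=> /LK_fwd[].
- by move=> /LK_fwd[_ <-]; rewrite TK.
- by move=> [[_ Lu] _]; exact: LK_bwd.
- by move=> [[_ Lu] _]; rewrite TK; have [] := LK_fwd _ (LK_bwd _ Lu).
Qed.
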